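(* Let $p\in[1,2)$ be a real number and let $\Psi\colon\mathcal{W}_p(\mathbb{T},r)\to\mathcal{W}_p(\mathbb{T},r)$ be an isometry. Then there exists an isometry $\psi\colon(\mathbb{T},r)\to(\mathbb{T},r)$ such that $\Psi=\psi_\#$.
   Context: $\mathbb{T}=\{z\in\mathbb{C} : |z|=1\}$ is equipped with the distance $r(z,\omega)=\left|\tfrac12(z-\omega)\right|$. The space $\mathcal{W}_p(\mathbb{T},r)$ is the set of all Borel probability measures on $\mathbb{T}$ endowed with the metric $$d_{\mathcal{W}_p}(\mu,\nu)=\left(\inf_{\pi\in\Pi(\mu,\nu)}\iint_{\mathbb{T}\times\mathbb{T}}\left|\tfrac12(z-\omega)\right|^p\,\mathrm{d}\pi(z,\omega)\right)^{1/p},$$ where $\Pi(\mu,\nu)$ is the set of couplings of $\mu$ and $\nu$, i.e. Borel probability measures on $\mathbb{T}\times\mathbb{T}$ with first marginal $\mu$ and second marginal $\nu$. An isometry of a metric space is a surjective distance-preserving map from the space onto itself. The push-forward $\psi_\#$ of a Borel map $\psi\colon\mathbb{T}\to\mathbb{T}$ is given by $(\psi_\#\mu)(A)=\mu(\psi^{-1}[A])$ for Borel sets $A\subseteq\mathbb{T}$. *)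

(* Defs.v *)
From HB Require Import structures.
From mathcomp Require Import all_boot all_order all_algebra.
From mathcomp Require Import complex.
From mathcomp Require Import all_classical all_reals all_analysis.

Set Implicit Arguments.
Unset Strict Implicit.
Unset Printing Implicit Defensive.

Import Order.TTheory GRing.Theory Num.Theory.
Import numFieldTopology.Exports numFieldNormedType.Exports.

Local Open Scope classical_set_scope.
Local Open Scope ring_scope.

(* The library norm `|z| on R[i] takes its values in R[i]; [normc z] is the
   same number seen in R. *)
Notation normc := ComplexField.Normc.normc.

Definition circle (R : realType) : Type := {z : R[i] | normc z == 1}.

Section circle_metric.
Context {R : realType}.
Implicit Types z w : circle R.

Definition circle_dist z w : R := normc (2^-1 * (val z - val w)).

Let normc_normr (x : R[i]) : `|x| = (normc x)%:C%C.
Proof. by []. Qed.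

Let circle_distxx z : circle_dist z z = 0.
Proof. by rewrite /circle_dist subrr mulr0 ComplexField.Normc.normc0. Qed.

Let circle_dist0_eq z w : circle_dist z w = 0 -> z = w.
Proof.
move=> /ComplexField.Normc.eq0_normc/eqP.
rewrite mulf_eq0 invr_eq0 pnatr_eq0/= subr_eq0 => /eqP.
exact: val_inj.
Qed.

Let circle_dist_sym z w : circle_dist z w = circle_dist w z.
Proof.
by apply: complexI; rewrite /circle_dist -!normc_normr !normrM distrC.
Qed.

Let circle_dist_triangle w z v :
  circle_dist z v <= circle_dist z w + circle_dist w v.
Proof.
rewrite -lecR rmorphD/= /circle_dist -!normc_normr !normrM -mulrDr.
by rewrite ler_wpM2l// ler_distD.
Qed.

HB.instance Definition _ := Choice.on (circle R).
HB.instance Definition _ := @isMetric.Build R (circle R) circle_dist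
  circle_distxx circle_dist0_eq circle_dist_sym circle_dist_triangle.

End circle_metric.

Section circle_borel.
Variable R : realType.

Let circle1_subproof : normc (1 : R[i]) == 1.
Proof. by rewrite ComplexField.Normc.normc1. Qed.

Definition circle1 : circle R := exist _ (1 : R[i]) circle1_subproof.

(* [g_sigma_algebraType] asks for a pointed carrier. *)
HB.instance Definition _ := isPointed.Build (circle R) circle1.

HB.instance Definition _ :=
  Measurable.copy (circle R) (g_sigma_algebraType (@open (circle R))).

End circle_borel.

(* Couplings below are probabilities for the product sigma-algebra; since the
   circle is separable it is the Borel sigma-algebra of the product. *)
Section circle_prod_borel.
Variable R : realType.

Let Re_lip (z w : circle R) :
  `|complex.Re (val z) - complex.Re (val w)| <= 2 * mdist z w.
Proof.
rewrite -lecR rmorphM/= /mdist/= /circle_dist.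
rewrite -[X in _ * X]/(`|2^-1 * (val z - val w)|) normrM ger0_norm ?invr_ge0//.
rewrite [X in X * _](_ : _ = 2) ?rmorph_nat// mulVKf ?pnatr_eq0//.
by rewrite -raddfB; exact: normc_ge_Re.
Qed.

Let Im_lip (z w : circle R) :
  `|complex.Im (val z) - complex.Im (val w)| <= 2 * mdist z w.
Proof.
rewrite -lecR rmorphM/= /mdist/= /circle_dist.
rewrite -[X in _ * X]/(`|2^-1 * (val z - val w)|) normrM ger0_norm ?invr_ge0//.
rewrite [X in X * _](_ : _ = 2) ?rmorph_nat// mulVKf ?pnatr_eq0//.
rewrite -raddfB; case: (val z - val w) => a b.
rewrite -[X in _ <= X]/(Num.sqrt (a ^+ 2 + b ^+ 2))%:C%C lecR.
by rewrite -sqrtr_sqr ler_wsqrtr// lerDr sqr_ge0.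
Qed.

Let dist_le_ReIm (z w : circle R) : mdist z w <=
  `|complex.Re (val z) - complex.Re (val w)| +
  `|complex.Im (val z) - complex.Im (val w)|.
Proof.
rewrite /mdist/= /circle_dist ComplexField.Normc.normcM.
have -> : normc (2^-1 : R[i]) = 2^-1.
  by rewrite ComplexField.Normc.normcV -[2]/(1 *+ 2) normcMn
    ComplexField.Normc.normc1.
rewrite -!raddfB; case: (val z - val w) => a b /=.
have h : Num.sqrt (a ^+ 2 + b ^+ 2) <= `|a| + `|b|.
  rewrite -(@ger0_norm _ (`|a| + `|b|)) ?addr_ge0// -sqrtr_sqr ler_wsqrtr//.
  rewrite sqrrD !real_normK ?num_real// -addrA [_ *+ 2 + _]addrC addrA lerDl.
  by rewrite mulrn_wge0// mulr_ge0.
rewrite (le_trans _ h)// ler_piMl ?sqrtr_ge0//.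
by rewrite invf_le1 ?ler1n ?ltr0n.
Qed.

Let lip_cont (f : circle R -> R) :
  (forall z w, `|f z - f w| <= 2 * mdist z w) -> continuous f.
Proof.
move=> fl z; apply/(@cvgrPdist_lt _ _ _ (nbhs z)) => e e0.
apply/(@metricType_numDomainType.nbhs_mdistP R (circle R)).
exists (e / 2) => /=; first by rewrite divr_gt0.
move=> w /= zw; rewrite (le_lt_trans (fl _ _))// mulrC -ltr_pdivlMr//.
Qed.

Let idx := (rat * rat * nat)%type.

Let box (i : idx) : set (circle R) :=
  [set z | `|complex.Re (val z) - ratr i.1.1| < i.2.+1%:R^-1] `&`
  [set z | `|complex.Im (val z) - ratr i.1.2| < i.2.+1%:R^-1].

Let open_slab (f : circle R -> R) a e :
  continuous f -> open [set z | `|f z - a| < e].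
Proof.
move=> cf; rewrite (_ : [set z | _] = f @^-1` (ball a e)); last first.
  by apply/seteqP; split => z /=; rewrite /ball/= distrC.
by move/continuousP : cf; apply; exact: ball_open.
Qed.

Let measurable_box i : measurable (box i).
Proof.
apply: measurableI; apply: sub_sigma_algebra; apply: open_slab;
  exact: lip_cont.
Qed.

Let box_cover (z : circle R) n : exists q : rat * rat, box (q, n) z.
Proof.
have n0 : 0 < n.+1%:R^-1 :> R by rewrite invr_gt0.
have h (x : R) : exists q, `|x - ratr q| < n.+1%:R^-1.
  have [|q] := @rat_in_itvoo R (x - n.+1%:R^-1) (x + n.+1%:R^-1).
    by rewrite ltrD2l (lt_trans _ n0)// oppr_lt0.
  by rewrite in_itv/= -ltr_distl distrC => ?; exists q.
have [q qz] := h (complex.Re (val z)); have [s sz] := h (complex.Im (val z)).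
by exists (q, s).
Qed.

Let box_small i z w : box i z -> box i w -> mdist z w <= 4 / i.2.+1%:R.
Proof.
move=> [z1 z2] [w1 w2]; rewrite (le_trans (dist_le_ReIm _ _))//.
have h (a b c e : R) : `|a - c| < e -> `|b - c| < e -> `|a - b| <= 2 * e.
  move=> ac bc; rewrite (le_trans (ler_distD c _ _))// (distrC c).
  by rewrite mulr_natl mulr2n lerD// ltW.
rewrite (_ : 4 / _ = 2 * i.2.+1%:R^-1 + 2 * i.2.+1%:R^-1).
  by rewrite lerD//; [exact: (h _ _ _ _ z1 w1)|exact: (h _ _ _ _ z2 w2)].
by rewrite -mulrDl -natrD.
Qed.

Lemma measurable_circle_prodE :
  @measurable _ (circle R * circle R)%type =
  <<s @open (circle R * circle R)%type >>.
Proof.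
rewrite measurable_prod_measurableType; apply/seteqP; split.
  apply: smallest_sub; first exact: smallest_sigma_algebra.
  move=> _ [A mA [B mB <-]].
  have mfst : measurable_fun setT
      (fst : g_sigma_algebraType (@open (circle R * circle R)%type) -> circle R).
    apply: (measurability (@open (circle R))) => //.
    move=> _ [C oC <-]; rewrite setTI; apply: sub_sigma_algebra.
    by apply: open_comp => // x _; exact: cvg_fst.
  have msnd : measurable_fun setT
      (snd : g_sigma_algebraType (@open (circle R * circle R)%type) -> circle R).
    apply: (measurability (@open (circle R))) => //.
    move=> _ [C oC <-]; rewrite setTI; apply: sub_sigma_algebra.
    by apply: open_comp => // x _; exact: cvg_snd.
  have := measurableI _ _ (mfst measurableT A mA) (msnd measurableT B mB).
  by rewrite !setTI.
rewrite -measurable_prod_measurableType.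
apply: smallest_sub; first exact: sigma_algebra_measurable.
move=> U oU.
pose F (k : idx * idx) : set (circle R * circle R) :=
  [set x | box k.1 `*` box k.2 `<=` U /\ (box k.1 `*` box k.2) x].
have -> : U = \bigcup_k F k.
  apply/seteqP; split => [[z w] Uzw|x [k _ [kU kx]]]; last exact: kU.
  have /= [[P Q] [/= zP wQ] PQU] : nbhs (z, w) U by exact: open_nbhs_nbhs.
  move: zP => /(@metricType_numDomainType.nbhs_mdistP R (circle R))[e/= e0 eP].
  move: wQ => /(@metricType_numDomainType.nbhs_mdistP R (circle R))[s/= s0 sQ].
  have m0 : 0 < Num.min e s / 4 by rewrite divr_gt0// lt_min e0.
  have [n] : exists n, n.+1%:R^-1 < Num.min e s / 4.
    have [n _] := near_infty_natSinv_lt (PosNum m0).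
    by move/(_ n (leqnn n)) => /=; exists n.
  rewrite ltr_pdivlMr// mulrC lt_min => /andP[ne ns].
  have [q qz] := box_cover z n; have [t tw] := box_cover w n.
  exists ((q, n), (t, n)) => //; split => // -[z' w'] [/= z'q w't].
  apply: PQU; split => /=.
    by apply: eP => /=; rewrite (le_lt_trans (box_small qz z'q)).
  by apply: sQ => /=; rewrite (le_lt_trans (box_small tw w't)).
apply: countable_bigcupT_measurable => [|k]; first exact: countableP.
have [kU|kU] := pselect (box k.1 `*` box k.2 `<=` U).
  rewrite (_ : F k = box k.1 `*` box k.2); first exact: measurableX.
  by apply/seteqP; split => [x []|x kx].
by rewrite (_ : F k = set0)//; apply/seteqP; split => [x []|].
Qed.

End circle_prod_borel.

Section wasserstein.
Context {R : realType}.
Local Open Scope ereal_scope.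

(* The library's measures are functions on all subsets, unconstrained off the
   sigma-algebra, so two representatives of the same Borel measure need not be
   Leibniz-equal: Borel measures are compared on measurable sets only. *)
Definition eq_borel (mu nu : set (circle R) -> \bar R) : Prop :=
  forall A, measurable A -> mu A = nu A.

Definition coupling (mu nu : probability (circle R) R) :
    set (probability (circle R * circle R)%type R) :=
  [set g | eq_borel (pushforward g fst) mu /\ eq_borel (pushforward g snd) nu].

Definition wasserstein_dist (p : R) (mu nu : probability (circle R) R) :
    \bar R :=
  (ereal_inf [set \int[g]_x ((mdist x.1 x.2) `^ p)%:E
             | g in coupling mu nu]) `^ p^-1.

Definition wasserstein_isometry (p : R)
    (Psi : probability (circle R) R -> probability (circle R) R) : Prop :=
  (forall nu, exists mu, eq_borel (Psi mu) nu) /\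
  (forall mu nu,
     wasserstein_dist p (Psi mu) (Psi nu) = wasserstein_dist p mu nu).

End wasserstein.

Definition metric_isometry (R : realType) (T : metricType R) (f : T -> T) :
    Prop :=
  (forall y, exists x, f x = y) /\
  (forall x y, mdist (f x) (f y) = mdist x y).

(* Main.v *)
From HB Require Import structures.
From mathcomp Require Import all_boot all_order all_algebra.
From mathcomp Require Import complex.
From mathcomp Require Import all_classical all_reals all_analysis.
From mathcomp Require Import measurable_realfun.
From mathcomp Require Import ring lra.
Require Import Defs.

Set Implicit Arguments.
Unset Strict Implicit.
Unset Printing Implicit Defensive.

Import Order.TTheory GRing.Theory Num.Theory.
Import numFieldTopology.Exports numFieldNormedType.Exports.

Local Open Scope classical_set_scope.
Local Open Scope ring_scope.

(** Everything is decided by the Dirac masses.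

The circle has diameter 1, and the distance of two probabilities mu and nu
equals 1 only if the cost is 1 almost everywhere for the product coupling; the
only point at distance 1 from z is its antipode, so this forces nu to be a Dirac
mass ([wasserstein_eq1_dirac]). Dirac masses at antipodal points are at distance
1, so an isometry Psi sends Dirac masses to Dirac masses, and it thereby induces
an isometry psi of the circle ([dirac_image]). Since the only coupling of mu
with a Dirac mass is the product, the p-th power of the distance from mu to the
Dirac mass at z is the potential of mu at z, that is, the integral of
mdist w z `^ p with respect to mu ([wasserstein_dirac]). Hence Psi mu and the
pushforward of mu by psi have the same potential at every point.

It remains to see that the potential determines the measure
([potential_inj]), and this is where p < 2 matters. In the coordinates of the
plane, mdist w z `^ p is a constant times (1 - <w, z>) `^ a with a = p / 2 < 1,
and all the coefficients c_k, k >= 1, of the power series of (1 - t) `^ a are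
negative. Let L be the difference of the integrals against two probabilities
with equal potentials. Applying L to both variables of (1 - <w, z>) `^ a gives
0, while on <w, z> ^+ k it gives a combination with positive coefficients of the
squares of the differences of the moments of degree k. A sum of nonpositive
terms c_k * energy k can only vanish if all the moments agree ([energy_eq0],
[moment_eq0]). To stay clear of the boundary of the disc of convergence the
series is evaluated at r * t with r < 1 ([pow1B_approx]).

Finally the moments determine the measure: the polynomials
(1 - u ^+ n) ^+ (n * 2 ^ n) converge boundedly to the indicator of u < 1/2
([stone_poly_cvg]), so the two measures agree on all the quadrants
{x < s, y < t} ([moments_quadrant]), which form a pi-system generating the Borel
sets of the circle ([circle_measurableE]). *)

(** * The power series of (1 - t) `^ a *)

Section one_sub_powR.
Context {R : realType} (a : R).
Hypotheses (a_gt0 : 0 < a) (a_lt1 : a < 1).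

(** The coefficients (-1)^n binom(a, n). *)
Fixpoint pow1B_coef (n : nat) : R :=
  if n is m.+1 then (m%:R - a) / m.+1%:R * pow1B_coef m else 1.

Definition pow1B_sum (n : nat) (t : R) : R :=
  \sum_(k < n.+1) pow1B_coef k * t ^+ k.

Lemma pow1B_coefS n : n.+1%:R * pow1B_coef n.+1 = (n%:R - a) * pow1B_coef n.
Proof. by rewrite /= -mulrA mulrCA mulVKf. Qed.

Lemma pow1B_coef_lt0 n : pow1B_coef n.+1 < 0.
Proof.
elim: n => [|n ih].
  by rewrite /= mulr1 invr1 mulr1 sub0r oppr_lt0.
rewrite [pow1B_coef _]/= nmulr_llt0// divr_gt0// subr_gt0.
by rewrite (lt_le_trans a_lt1)// ler1n.
Qed.

(** The recurrence makes n * |c_n| nonincreasing in n, starting from a. *)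
Lemma pow1B_coef_le n : - (n.+1%:R * pow1B_coef n.+1) <= 1.
Proof.
elim: n => [|n ih].
  by rewrite pow1B_coefS mulr1 sub0r opprK ltW.
rewrite pow1B_coefS (le_trans _ ih)// lerN2.
rewrite ler_wnM2r ?(ltW (pow1B_coef_lt0 _))//.
by rewrite gerBl ltW.
Qed.

Lemma is_derive_pow1B_sum n (t : R) :
  is_derive t 1 (pow1B_sum n)
    (\sum_(k < n.+1) pow1B_coef k * (k%:R * t ^+ k.-1)).
Proof.
have -> : pow1B_sum n = \sum_(k < n.+1) (fun t => pow1B_coef k * t ^+ k).
  by apply/funext => x; rewrite fct_sumE.
apply: is_derive_sum => k.
have -> : (fun t : R => pow1B_coef k * t ^+ k) = pow1B_coef k *: (@id R ^+ k).
  by apply/funext => x; rewrite exprfctE.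
apply: is_derive_eq.
by rewrite /= /GRing.scale/= mulr1 -mulr_natl mulrA.
Qed.

(** The full series solves (1 - t) f' + a f = 0; for a partial sum everything
telescopes except for one monomial. *)
Lemma pow1B_sum_ode n (t : R) :
  (1 - t) * (\sum_(k < n.+1) pow1B_coef k * (k%:R * t ^+ k.-1)) +
    a * pow1B_sum n t
  = (a - n%:R) * pow1B_coef n * t ^+ n.
Proof.
rewrite /pow1B_sum; elim: n => [|n ih].
  by rewrite !big_ord1 /=; ring.
have cE := pow1B_coefS n.
rewrite !(big_ord_recr n.+1) [_ n.+1.-1]/= [\val _]/= mulrDr mulrDr addrACA ih.
move: cE; move: (pow1B_coef n) (pow1B_coef n.+1) => c c'.
rewrite -natr1 [t ^+ n.+1]exprSr => cE.
apply/subr0_eq; transitivity (((n%:R + 1) * c' - (n%:R - a) * c) * t ^+ n).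
  by ring.
by rewrite cE subrr mul0r.
Qed.

Lemma pow1B_sum0 n : pow1B_sum n 0 = 1.
Proof.
rewrite /pow1B_sum big_ord_recl expr0 mulr1 big1 ?addr0// => k _.
by rewrite expr0n mulr0.
Qed.

Let g n (t : R) := pow1B_sum n t * (1 - t) `^ (- a).

Let g' n (t : R) :=
  (1 - t) `^ (- a - 1) * ((a - n%:R) * pow1B_coef n * t ^+ n).

Let is_derive_g n (t : R) : t < 1 -> is_derive t 1 (g n) (g' n t).
Proof.
move=> t1; have t1' : 0 < 1 - t by rewrite subr_gt0.
have dp : is_derive t 1 (fun t => (1 - t) `^ (- a)) (a * (1 - t) `^ (- a - 1)).
  have dl : is_derive t 1 (fun t : R => 1 - t) (-1).
    by have := @is_deriveB R R R (cst 1) id t 1 0 1 _ _; rewrite sub0r; apply.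
  have := @is_derive1_comp R (fun x : R => x `^ (- a)) (fun t => 1 - t) t _ _
    (@is_derive1_powR R (- a) _ t1') dl.
  by move=> /is_derive_eq; apply; ring.
have := @is_deriveM _ _ _ _ _ _ _ _ (is_derive_pow1B_sum n t) dp.
move=> /is_derive_eq; apply; rewrite /g' /GRing.scale/= -pow1B_sum_ode.
have -> : (1 - t) `^ (- a) = (1 - t) * (1 - t) `^ (- a - 1).
  rewrite -{2}[1 - t]powRr1 ?ltW// -powRD; last first.
    by apply/implyP => _; rewrite gt_eqF.
  by congr (_ `^ _); ring.
ring.
Qed.

(** Mean value theorem for the ratio of the partial sum to (1 - t) `^ a, which
is 1 at the origin and whose derivative is of order r ^+ n by
[pow1B_sum_ode]. *)
Lemma pow1B_sum_err n (r t : R) : r < 1 -> `|t| <= r ->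
  `|pow1B_sum n t - (1 - t) `^ a| <= 2 * (r ^+ n / (1 - r) ^+ 2).
Proof.
move=> r1 tr; have r0 : 0 <= r by rewrite (le_trans _ tr).
have t1 : t < 1 by rewrite (le_lt_trans _ r1)// (le_trans _ tr)// ler_norm.
have tN1 : -1 <= t.
  rewrite lerNl (le_trans _ (ltW r1))// (le_trans _ tr)//.
  by rewrite ler_normr lexx orbT.
have pt0 : 0 < (1 - t) `^ a by rewrite powR_gt0// subr_gt0.
have -> : pow1B_sum n t - (1 - t) `^ a = (1 - t) `^ a * (g n t - g n 0).
  rewrite /g pow1B_sum0 subr0 powR1 powRN mulrBr !mulr1 [in RHS]mulrC mulfVK//.
  by rewrite gt_eqF.
rewrite normrM ger0_norm ?powR_ge0//.
apply: ler_pM; [exact: powR_ge0|exact: normr_ge0| |].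
  have : (1 - t) `^ a <= 2 `^ a.
    by apply: ge0_ler_powR; rewrite ?nnegrE ?(ltW a_gt0)//; lra.
  by move=> /le_trans; apply; rewrite ler1_powR ?ler1n// ltW.
have bound c : `|c| <= r -> `|g' n c| <= r ^+ n / (1 - r) ^+ 2.
  move=> cr; have rc : 1 - r <= 1 - c.
    by rewrite lerD2l lerN2 (le_trans _ cr)// ler_norm.
  rewrite /g' mulrC normrM ler_pM//.
    rewrite normrM normrX -[leRHS]mul1r ler_pM//.
      rewrite -opprB mulNr normrN -pow1B_coefS ler0_norm ?pow1B_coef_le//.
      by rewrite pmulr_rle0// ltW// pow1B_coef_lt0.
    by rewrite lerXn2r ?nnegrE.
  rewrite ger0_norm ?powR_ge0// -opprD powRN.
  rewrite lef_pV2 ?posrE ?exprn_gt0 ?powR_gt0 ?subr_gt0//; last first.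
    by rewrite (le_lt_trans _ r1)// (le_trans _ cr)// ler_norm.
  have v0 : 0 < 1 - r by rewrite subr_gt0.
  rewrite -powR_mulrn ?(ltW v0)// (@le_trans _ _ ((1 - r) `^ (a + 1)))//.
    by rewrite ger_powR// ?v0/=; have := a_gt0; have := a_lt1; lra.
  have a1 : 0 <= a + 1 by rewrite addr_ge0// ltW.
  by apply: (ge0_ler_powR a1); rewrite ?nnegrE//; lra.
have dg (x : R) : `|x| <= r -> is_derive x 1 (g n) (g' n x).
  move=> xr; apply: is_derive_g.
  by rewrite (le_lt_trans _ r1)// (le_trans _ xr)// ler_norm.
have lemt c : `|c| <= r -> `|g' n c * t| <= r ^+ n / (1 - r) ^+ 2.
  move=> cr; rewrite normrM -[leRHS]mulr1 ler_pM ?bound//.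
  by rewrite (le_trans tr)// ltW.
have [t0|/ltW t0] := leP 0 t.
  rewrite ger0_norm// in tr.
  have cr x : x \in `[0, t]%R -> `|x| <= r.
    by rewrite in_itv/= => /andP[x0 xt]; rewrite ger0_norm// (le_trans xt).
  have [|c ct ->] := @MVT_segment R (g n) _ 0 t t0
    (fun x xt => dg x (cr _ (subset_itv_oo_cc xt))).
    by apply: derivable_within_continuous => x /cr xr; have [] := dg x xr.
  by rewrite subr0 lemt// cr.
rewrite distrC.
rewrite ler0_norm// in tr.
have cr x : x \in `[t, 0]%R -> `|x| <= r.
  rewrite in_itv/= => /andP[tx x0].
  by rewrite ler0_norm// (le_trans _ tr)// lerN2.
have [|c ct ->] := @MVT_segment R (g n) _ t 0 t0
  (fun x xt => dg x (cr _ (subset_itv_oo_cc xt))).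
  by apply: derivable_within_continuous => x /cr xr; have [] := dg x xr.
by rewrite sub0r mulrN normrN lemt// cr.
Qed.

(** For a ratio u in [0, 1] one has u <= u `^ a; apply this to x / (x + y) and
y / (x + y), whose sum is 1. *)
Lemma powR_subadd (x y : R) : 0 <= x -> 0 <= y ->
  (x + y) `^ a <= x `^ a + y `^ a.
Proof.
move=> x0 y0; have [s0|s0] := eqVneq (x + y) 0.
  by rewrite s0 powR0 ?gt_eqF// addr_ge0 ?powR_ge0.
have {}s0 : 0 < x + y by rewrite lt_neqAle eq_sym s0 addr_ge0.
have h (u : R) : 0 <= u -> u <= x + y -> u / (x + y) * (x + y) `^ a <= u `^ a.
  move=> u0 us; have [->|u1] := eqVneq u 0; first by rewrite !mul0r powR_ge0.
  have {2}-> : u = u / (x + y) * (x + y) by rewrite mulfVK// gt_eqF.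
  rewrite powRM ?divr_ge0 ?(ltW s0)// ler_wpM2r ?powR_ge0//.
  have u0' : 0 < u by rewrite lt_neqAle eq_sym u1.
  rewrite ger1_powR ?(ltW a_lt1)// divr_gt0//=.
  by rewrite ler_pdivrMr// mul1r.
have hx : x <= x + y by rewrite lerDl.
have hy : y <= x + y by rewrite lerDr.
apply: le_trans (lerD (h x x0 hx) (h y y0 hy)).
by rewrite -mulrDl -mulrDl divff ?mul1r// gt_eqF.
Qed.

Lemma powR_holder (x y : R) : 0 <= x -> 0 <= y ->
  `|x `^ a - y `^ a| <= `|x - y| `^ a.
Proof.
wlog xy : x y / y <= x => [hw x0 y0|x0 y0].
  have [|/ltW] := leP y x => xy; first exact: hw.
  by rewrite distrC [X in _ <= X `^ a]distrC hw.
have xy' : y `^ a <= x `^ a by exact: (ge0_ler_powR (ltW a_gt0)).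
rewrite !ger0_norm ?subr_ge0// lerBlDr.
by rewrite (le_trans _ (powR_subadd _ _)) ?subr_ge0// subrK.
Qed.

(** The bound of [pow1B_sum_err] degenerates as r tends to 1, but (1 - t) `^ a
is Hoelder continuous, so t may be contracted to r * t first. The lower bound on
r keeps the coefficient of each fixed degree away from 0 when e tends to 0. *)
Lemma pow1B_approx (e : R) : 0 < e -> exists r : R, 2^-1 <= r < 1 /\
  \forall n \near \oo, forall t, `|t| <= 1 ->
    `|pow1B_sum n (r * t) - (1 - t) `^ a| <= e.
Proof.
move=> e0; have e20 : 0 < e / 2 by rewrite divr_gt0.
pose d := Num.min (2^-1) ((e / 2) `^ a^-1).
have d0 : 0 < d by rewrite lt_min invr_gt0 ltr0n powR_gt0.
have d2 : d <= 2^-1 by rewrite ge_min lexx.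
have de : d `^ a <= e / 2.
  have -> : e / 2 = ((e / 2) `^ a^-1) `^ a.
    by rewrite -powRrM mulVf ?gt_eqF// powRr1// ltW.
  apply: (ge0_ler_powR (ltW a_gt0)); rewrite ?nnegrE ?powR_ge0 ?(ltW d0)//.
  by rewrite ge_min lexx orbT.
exists (1 - d); split; first by apply/andP; split; lra.
have r0 : 0 <= 1 - d by lra.
have r1 : `|1 - d| < 1 by rewrite ger0_norm//; lra.
have : 2 * ((1 - d) ^+ n / (1 - (1 - d)) ^+ 2) @[n --> \oo] -->
    (2 * (0 / (1 - (1 - d)) ^+ 2) : R).
  by apply: cvgMr; apply: cvgMl; exact: cvg_expr.
rewrite mul0r mulr0 => /cvgrPdist_le/(_ _ e20).
apply: filterS => n; rewrite sub0r normrN => ne t t1.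
have rt : `|(1 - d) * t| <= 1 - d by rewrite normrM ger0_norm// ler_piMr.
have := pow1B_sum_err n (le_lt_trans (ler_norm _) r1) rt.
set s := pow1B_sum _ _ => h1.
have h2 : `|(1 - (1 - d) * t) `^ a - (1 - t) `^ a| <= e / 2.
  rewrite (le_trans (powR_holder _ _))//.
  - by rewrite subr_ge0 (le_trans (ler_norm _))// (le_trans rt)//; lra.
  - by rewrite subr_ge0 (le_trans (ler_norm _)).
  rewrite (le_trans _ de)//.
  apply: (ge0_ler_powR (ltW a_gt0)); rewrite ?nnegrE ?(ltW d0)//.
  have -> : 1 - (1 - d) * t - (1 - t) = d * t by ring.
  by rewrite normrM ger0_norm ?(ltW d0)// ler_piMr// ltW.
rewrite (le_trans (ler_distD ((1 - (1 - d) * t) `^ a) _ _))//.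
rewrite [leRHS](_ : e = e / 2 + e / 2); last by lra.
by rewrite lerD// (le_trans h1)// (le_trans (ler_norm _)).
Qed.

End one_sub_powR.

Arguments pow1B_coef : simpl never.

(** * Integrating bounded functions against two probabilities *)

Section bounded_measurable.
Context d (T : measurableType d) (R : realType).
Implicit Types h k : T -> R.

Definition bounded_mfun h :=
  measurable_fun setT h /\ exists M, forall x, `|h x| <= M.

Lemma bounded_mfun_cst (c : R) : bounded_mfun (fun=> c).
Proof. by split; [exact: measurable_cst|exists `|c|]. Qed.

Lemma bounded_mfunD h k : bounded_mfun h -> bounded_mfun k ->
  bounded_mfun (fun x => h x + k x).
Proof.
move=> [mh [M hM]] [mk [N kN]]; split; first exact: measurable_funD.
by exists (M + N) => x; rewrite (le_trans (ler_normD _ _))// lerD.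
Qed.

Lemma bounded_mfunM h k : bounded_mfun h -> bounded_mfun k ->
  bounded_mfun (fun x => h x * k x).
Proof.
move=> [mh [M hM]] [mk [N kN]]; split; first exact: measurable_funM.
by exists (M * N) => x; rewrite normrM ler_pM.
Qed.

Lemma bounded_mfunX h n : bounded_mfun h -> bounded_mfun (fun x => h x ^+ n).
Proof.
move=> bh; elim: n => [|n ih]; first exact: bounded_mfun_cst.
by under [fun x => _]funext do rewrite exprS; exact: bounded_mfunM.
Qed.

Lemma bounded_mfun_sum (I : Type) (s : seq I) (h : I -> T -> R) :
  (forall i, bounded_mfun (h i)) -> bounded_mfun (fun x => \sum_(i <- s) h i x).
Proof.
move=> bh; elim: s => [|i s ih].
  by under [fun x => _]funext do rewrite big_nil; exact: bounded_mfun_cst.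
by under [fun x => _]funext do rewrite big_cons; exact: bounded_mfunD.
Qed.

Lemma bounded_mfun_indic A : measurable A -> bounded_mfun (\1_A : T -> R).
Proof.
move=> mA; split; first exact: measurable_indic.
by exists 1 => x; rewrite indicE ger0_norm// lern1 leq_b1.
Qed.

Lemma bounded_mfun_integrable (mu : probability T R) h :
  bounded_mfun h -> mu.-integrable setT (EFin \o h).
Proof.
move=> [mh [M hM]]; apply: measurable_bounded_integrable => //.
  by rewrite (le_lt_trans (probability_le1 _ _))// ltry.
exists M; split; first by rewrite num_real.
by move=> M' MM' x _; apply: (le_trans (hM x)); exact: ltW.
Qed.

Lemma measurable_lt_cst h (c : R) :
  measurable_fun setT h -> measurable [set x | h x < c].
Proof.
move=> mh; rewrite -[X in measurable X]setTI.
have -> : [set x | h x < c] = h @^-1` `]-oo, c[.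
  by apply/seteqP; split => x /=; rewrite in_itv.
by apply: mh => //; exact: measurable_itv.
Qed.

Lemma Rintegral_probability_cst (mu : probability T R) (c : R) :
  \int[mu]_x c = c.
Proof.
transitivity (c * fine (mu setT)); first exact: Rintegral_cst.
by rewrite probability_setT mulr1.
Qed.

End bounded_measurable.

Section difference_of_probabilities.
Context d (T : measurableType d) (R : realType) (mu nu : probability T R).
Implicit Types h k : T -> R.

Definition dint h : R := \int[mu]_x h x - \int[nu]_x h x.

Lemma dintD h k : bounded_mfun h -> bounded_mfun k ->
  dint (fun x => h x + k x) = dint h + dint k.
Proof.
move=> bh bk; rewrite /dint !RintegralD//; try exact: bounded_mfun_integrable.
by rewrite addrACA opprD.
Qed.

Lemma dintZ (c : R) h : bounded_mfun h -> dint (fun x => c * h x) = c * dint h.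
Proof.
move=> bh; rewrite /dint !RintegralZl//; try exact: bounded_mfun_integrable.
by rewrite mulrBr.
Qed.

Lemma dint_cst (c : R) : dint (fun=> c) = 0.
Proof. by rewrite /dint !Rintegral_probability_cst subrr. Qed.

Lemma dint_sum (I : Type) (s : seq I) (h : I -> T -> R) :
  (forall i, bounded_mfun (h i)) ->
  dint (fun x => \sum_(i <- s) h i x) = \sum_(i <- s) dint (h i).
Proof.
move=> bh; elim: s => [|i s ih].
  by under [fun x => _]funext do rewrite big_nil; rewrite big_nil dint_cst.
under [fun x => _]funext do rewrite big_cons.
by rewrite big_cons dintD ?ih//; exact: bounded_mfun_sum.
Qed.

Lemma dintB h k : bounded_mfun h -> bounded_mfun k ->
  dint (fun x => h x - k x) = dint h - dint k.
Proof.
move=> bh bk; under [fun x => _]funext do rewrite -mulN1r.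
rewrite dintD ?dintZ ?mulN1r//.
by apply: bounded_mfunM => //; exact: bounded_mfun_cst.
Qed.

Lemma dint_le (M : R) h :
  bounded_mfun h -> (forall x, `|h x| <= M) -> `|dint h| <= 2 * M.
Proof.
move=> bh hM.
have hl (m : probability T R) : `|\int[m]_x h x| <= M.
  have im := bounded_mfun_integrable m bh.
  apply: (le_trans (le_normr_Rintegral _ im)) => //.
  have -> : M = \int[m]_x M by rewrite Rintegral_probability_cst.
  apply: le_Rintegral => //; last first.
    by apply: bounded_mfun_integrable; exact: bounded_mfun_cst.
  apply: bounded_mfun_integrable; split; last first.
    by exists M => x; rewrite normr_id.
  by apply: measurableT_comp => //; exact: bh.1.
by rewrite /dint (le_trans (ler_normB _ _))// mulr_natl mulr2n lerD.
Qed.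

Lemma dint_bounded_cvg0 (M : R) (h_ : nat -> T -> R) h :
  (forall n, bounded_mfun (h_ n)) -> (forall n x, `|h_ n x| <= M) ->
  measurable_fun setT h ->
  (forall x, h_ n x @[n --> \oo] --> h x) ->
  (forall n, dint (h_ n) = 0) -> dint h = 0.
Proof.
move=> bh hM mh hh h0.
have hc (m : probability T R) : \int[m]_x h_ n x @[n --> \oo] --> \int[m]_x h x.
  have [|||||ih _ cv] := @dominated_convergence _ _ _ m _ measurableT
    (fun n => EFin \o h_ n) (EFin \o h) (cst M%:E).
  - by move=> n; apply/measurable_EFinP; exact: (bh n).1.
  - exact/measurable_EFinP.
  - by apply: aeW => x _; apply: cvg_EFin; [exact: nearW|exact: hh].
  - exact: (bounded_mfun_integrable m (bounded_mfun_cst _ M)).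
  - by apply: aeW => x n _; exact: hM.
  by apply: fine_cvg; rewrite fineK//; exact: integrable_fin_num.
have : dint (h_ n) @[n --> \oo] --> dint h by apply: cvgB.
under eq_fun do rewrite h0.
by move=> /cvg_lim => <-//; rewrite lim_cst.
Qed.

Lemma dint_indic A : measurable A -> dint \1_A = 0 -> mu A = nu A.
Proof.
move=> mA; rewrite /dint /Rintegral !integral_indic// setIT => /subr0_eq e.
by rewrite -[LHS]fineK ?fin_num_measure// e fineK// fin_num_measure.
Qed.

End difference_of_probabilities.

(** * Polynomials converging to an indicator *)

Section stone.
Context {R : realType}.
Implicit Types u x : R.

Lemma bernoulli_1B x n : 0 <= x <= 1 -> 1 - n%:R * x <= (1 - x) ^+ n.
Proof.
move=> /andP[x0 x1]; elim: n => [|n ih]; first by rewrite mul0r subr0.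
rewrite exprS (le_trans _ (ler_wpM2l _ ih)) ?subr_ge0//.
rewrite -natr1 -subr_ge0.
have -> : (1 - x) * (1 - n%:R * x) - (1 - (n%:R + 1) * x) =
    n%:R * (x * x) by ring.
by rewrite !mulr_ge0.
Qed.

Lemma bernoulli_1D x n : 0 <= x -> 1 + n%:R * x <= (1 + x) ^+ n.
Proof.
move=> x0; elim: n => [|n ih]; first by rewrite mul0r addr0.
rewrite exprS (le_trans _ (ler_wpM2l _ ih)) ?addr_ge0//.
rewrite -natr1 -subr_ge0.
have -> : (1 + x) * (1 + n%:R * x) - (1 + (n%:R + 1) * x) =
    n%:R * (x * x) by ring.
by rewrite !mulr_ge0.
Qed.

(** Write x = y ^+ 2: then n * y ^+ n stays bounded while the other factor
y ^+ n tends to 0. *)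
Lemma cvg_natmul_expr0 x : 0 <= x < 1 -> n%:R * x ^+ n @[n --> \oo] --> (0 : R).
Proof.
move=> /andP[x0 x1].
pose y := Num.sqrt x; have y0 : 0 <= y by rewrite sqrtr_ge0.
have y1 : y < 1 by rewrite -sqrtr1 ltr_sqrt.
have bnd n : n%:R * x ^+ n <= y ^+ n / (1 - y).
  have h : n%:R * y ^+ n * (1 - y) <= 1 - y ^+ n.
    elim: n => [|n ih]; first by rewrite !mul0r subrr.
    have yn : 0 <= 1 - y ^+ n.+1 by rewrite subr_ge0 exprn_ile1// ltW.
    have : 0 <= (1 - y) * (1 - y ^+ n.+1) by rewrite mulr_ge0// subr_ge0 ltW.
    have := ler_wpM2l y0 ih; rewrite -natr1 exprS.
    by move: (n%:R) (y ^+ n) => N Y; lra.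
  rewrite -(sqr_sqrtr x0) -/y -exprM mulnC exprM expr2 mulrA [leRHS]mulrC.
  rewrite ler_wpM2r ?exprn_ge0// -(@ler_pM2r _ (1 - y)) ?subr_gt0//.
  rewrite mulVf ?gt_eqF ?subr_gt0// (le_trans h)//.
  by rewrite gerBl exprn_ge0.
apply: (@squeeze_cvgr _ _ _ _ (cst 0) (fun n => y ^+ n / (1 - y))).
- by apply: nearW => n; rewrite bnd /= mulr_ge0 ?exprn_ge0.
- exact: cvg_cst.
rewrite -[X in _ --> X](mul0r ((1 - y)^-1)); apply: cvgMl.
by apply: cvg_expr; rewrite ger0_norm.
Qed.

Lemma stone_poly_ge0_le1 u n m : 0 <= u <= 1 -> 0 <= (1 - u ^+ n) ^+ m <= 1.
Proof.
move=> /andP[u0 u1].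
have h : 0 <= 1 - u ^+ n by rewrite subr_ge0 exprn_ile1.
by rewrite exprn_ge0// exprn_ile1// gerBl exprn_ge0.
Qed.

(** Stone's approximation of a jump. By Bernoulli's inequality the value is at
least 1 - n * (2 * u) ^+ n, and, since (1 - v) * (1 + v) <= 1, at most the
inverse of 1 + n * (2 * u) ^+ n. The factor n in the exponent makes the limit 0,
instead of 1/e, at u = 1/2. *)
Lemma stone_poly_cvg u : 0 <= u <= 1 ->
  (1 - u ^+ n) ^+ (n * 2 ^ n) @[n --> \oo] --> ((u < 2^-1)%R%:R : R).
Proof.
move=> u01; have /andP[u0 u1] := u01.
have un n : 0 <= u ^+ n <= 1 by rewrite exprn_ge0//= exprn_ile1.
have NE n : (n * 2 ^ n)%:R * u ^+ n = n%:R * (2 * u) ^+ n.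
  by rewrite natrM natrX exprMn mulrA.
have [ult|uge] := ltP u 2^-1.
  apply: (@squeeze_cvgr _ _ _ _ (fun n => 1 - n%:R * (2 * u) ^+ n) (cst 1)).
  - apply: nearW => n; have /andP[_ ->] := stone_poly_ge0_le1 n (n * 2 ^ n) u01.
    by rewrite -NE bernoulli_1B.
  - rewrite -[X in _ --> X](subr0 1); apply: cvgB; first exact: cvg_cst.
    by apply: cvg_natmul_expr0; lra.
  - exact: cvg_cst.
apply: (@squeeze_cvgr _ _ _ _ (cst 0) (@harmonic R)).
- apply: nearW => n; have /andP[-> _]/= := stone_poly_ge0_le1 n (n * 2 ^ n) u01.
  rewrite -[leRHS]mul1r ler_pdivlMr ?ltr0n//.
  have /andP[v0 v1] := un n.
  have : (1 - u ^+ n) ^+ (n * 2 ^ n) * (1 + u ^+ n) ^+ (n * 2 ^ n) <= 1.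
    rewrite -exprMn exprn_ile1//; last first.
      by rewrite -subr_ge0; move: (u ^+ n) v0 v1 => v; nra.
    by rewrite mulr_ge0// ?subr_ge0// addr_ge0.
  apply: le_trans; rewrite ler_wpM2l ?exprn_ge0 ?subr_ge0//.
  rewrite (le_trans _ (bernoulli_1D _ v0))// NE -nat1r lerD2l ler_peMr//.
  by rewrite exprn_ege1//; lra.
- exact: cvg_cst.
- exact: cvg_harmonic.
Qed.

End stone.

(** * Moments determine a measure *)

Section moments_to_measure.
Context d (T : measurableType d) (R : realType) (mu nu : probability T R).
Implicit Types (h m u f g : T -> R).

Local Notation L := (dint mu nu).

(** If L vanishes on a class of functions that is stable under multiplication by
u, then it also vanishes on the products of these functions with polynomials in
u, hence on the products with bounded limits of such polynomials. *)
Lemma dint_mul_indic_lt (M : set (T -> R)) u :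
  M `<=` (@bounded_mfun _ T R) -> (forall m, M m -> L m = 0) ->
  (forall m, M m -> M (fun x => u x * m x)) ->
  measurable_fun setT u -> (forall x, 0 <= u x <= 1) ->
  forall m, M m -> L (fun x => \1_[set x | u x < 2^-1] x * m x) = 0.
Proof.
move=> bM LM uM mu_ u01 m Mm.
have bu : bounded_mfun u.
  by split => //; exists 1 => x; have /andP[? ?] := u01 x; rewrite ger0_norm.
have uXM n k : M k -> M (fun x => u x ^+ n * k x).
  elim: n k => [|n ih] k Mk.
    by under [fun x => _]funext do rewrite expr0 mul1r.
  by under [fun x => _]funext do rewrite exprSr -mulrA; apply/ih/uM.
have b1u n : bounded_mfun (fun x => 1 - u x ^+ n).
  under [fun x => _]funext do rewrite -mulN1r.
  apply: bounded_mfunD; first exact: bounded_mfun_cst.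
  by apply: bounded_mfunM; [exact: bounded_mfun_cst|exact: bounded_mfunX].
have Lp n N k : M k -> L (fun x => (1 - u x ^+ n) ^+ N * k x) = 0.
  elim: N k => [|N ih] k Mk.
    by under [fun x => _]funext do rewrite expr0 mul1r; exact: LM.
  under [fun x => _]funext do rewrite exprSr -mulrA mulrBl mul1r mulrBr.
  have bk k' : M k' -> bounded_mfun (fun x => (1 - u x ^+ n) ^+ N * k' x).
    by move=> Mk'; apply: bounded_mfunM; [exact: bounded_mfunX|exact: bM].
  by rewrite dintB ?ih ?subrr//; [exact: uXM|exact: bk|apply: bk; exact: uXM].
have [mm [C mC]] := bM _ Mm.
apply: (@dint_bounded_cvg0 _ _ _ _ _ C
  (fun n x => (1 - u x ^+ n) ^+ (n * 2 ^ n) * m x)).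
- by move=> n; apply: bounded_mfunM; [exact: bounded_mfunX|exact: bM].
- move=> n x; have /andP[p0 p1] := stone_poly_ge0_le1 n (n * 2 ^ n) (u01 x).
  by rewrite normrM ger0_norm// -[leRHS]mul1r ler_pM.
- apply: measurable_funM => //; apply: measurable_indic.
  exact: measurable_lt_cst.
- move=> x; apply: cvgMl; rewrite indicE.
  have -> : (x \in [set x | u x < 2^-1]) = (u x < 2^-1)%R.
    by apply/idP/idP; rewrite inE.
  exact: stone_poly_cvg.
- by move=> n; apply: Lp.
Qed.

Variables f g : T -> R.
Hypotheses (mf : measurable_fun setT f) (mg : measurable_fun setT g).
Hypotheses (f1 : forall x, `|f x| <= 1) (g1 : forall x, `|g x| <= 1).

Let bf : bounded_mfun f. Proof. by split => //; exists 1. Qed.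
Let bg : bounded_mfun g. Proof. by split => //; exists 1. Qed.

(** Stability under products with monomials is part of the definition, so that
indicators of half-planes can be multiplied in one after the other. *)
Definition null_moments m : Prop := bounded_mfun m /\
  forall i j, L (fun x => m x * (f x ^+ i * g x ^+ j)) = 0.

Let bfg i j : bounded_mfun (fun x => f x ^+ i * g x ^+ j).
Proof. by apply: bounded_mfunM; apply: bounded_mfunX. Qed.

Lemma null_moments_dint m : null_moments m -> L m = 0.
Proof.
move=> [_ /(_ 0 0)%N].
by under [fun x => _]funext do rewrite !expr0 !mulr1.
Qed.

Lemma null_moments_mulf m : null_moments m -> null_moments (fun x => f x * m x).
Proof.
move=> [bm h]; split; first exact: bounded_mfunM.
move=> i j; rewrite -(h i.+1 j); congr L.
by apply/funext => x; rewrite exprS; ring.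
Qed.

Lemma null_moments_mulg m : null_moments m -> null_moments (fun x => g x * m x).
Proof.
move=> [bm h]; split; first exact: bounded_mfunM.
move=> i j; rewrite -(h i j.+1); congr L.
by apply/funext => x; rewrite exprS; ring.
Qed.

Lemma null_moments_lin (a b : R) m k : null_moments m -> null_moments k ->
  null_moments (fun x => a * m x + b * k x).
Proof.
move=> [bm mh] [bk kh].
have bZ c h : bounded_mfun h -> bounded_mfun (fun x => c * h x).
  by move=> bh; apply: bounded_mfunM => //; exact: bounded_mfun_cst.
split; first by apply: bounded_mfunD; exact: bZ.
move=> i j; under [fun x => _]funext do rewrite mulrDl -!mulrA.
have bmX h : bounded_mfun h ->
    bounded_mfun (fun x => h x * (f x ^+ i * g x ^+ j)).
  by move=> bh; exact: bounded_mfunM.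
by rewrite dintD ?dintZ ?mh ?kh ?mulr0 ?addr0//; do ?[exact: bmX|apply: bZ].
Qed.

(** An affine change of variable maps the range of h into [0, 1] and t to
1/2. *)
Lemma null_moments_indic (t : R) h m : (h = f \/ h = g) -> null_moments m ->
  null_moments (fun x => \1_[set x | h x < t] x * m x).
Proof.
move=> hfg nm.
have hm k : null_moments k -> null_moments (fun x => h x * k x).
  by case: hfg => ->; [exact: null_moments_mulf|exact: null_moments_mulg].
have h1 x : `|h x| <= 1 by case: hfg => ->.
have mh : measurable_fun setT h by case: hfg => ->.
pose c := (2 * (1 + `|t|))^-1.
have c0 : 0 < c by rewrite invr_gt0 mulr_gt0// ltr_pwDl.
pose u x := c * h x + (2^-1 - c * t).
have ut x : (u x < 2^-1)%R = (h x < t)%R.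
  by rewrite /u addrCA -ltrBrDl subrr -mulrBr pmulr_rlt0// subr_lt0.
have uE : [set x | h x < t] = [set x | u x < 2^-1].
  by apply/seteqP; split => x /=; rewrite ut.
have un k : null_moments k -> null_moments (fun x => u x * k x).
  move=> nk; under [fun x => _]funext do rewrite mulrDl -mulrA.
  by apply: null_moments_lin => //; exact: hm.
have mu_ : measurable_fun setT u.
  by apply: measurable_funD => //; exact: measurable_funM.
have u01 x : 0 <= u x <= 1.
  have : `|c * (h x - t)| <= 2^-1.
    rewrite normrM gtr0_norm// /c invfM -mulrA -[leRHS]mulr1 ler_wpM2l//.
    rewrite ler_pdivrMl ?ltr_pwDl// mulr1 (le_trans (ler_normB _ _))//.
    by rewrite lerD2r.
  by rewrite ler_norml /u => /andP[h2 h3]; apply/andP; split; lra.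
have nX k i j : null_moments k ->
    null_moments (fun x => k x * (f x ^+ i * g x ^+ j)).
  move=> [bk kh]; split; first exact: bounded_mfunM.
  move=> i' j'; rewrite -(kh (i + i')%N (j + j')%N).
  by congr L; apply/funext => x; rewrite !exprD; ring.
split.
  apply: bounded_mfunM; last exact: nm.1.
  by apply: bounded_mfun_indic; exact: measurable_lt_cst.
move=> i j; rewrite uE; under [fun x => _]funext do rewrite -mulrA.
apply: (@dint_mul_indic_lt null_moments) => //.
- by move=> k [].
- exact: null_moments_dint.
- exact: nX.
Qed.

Lemma moments_quadrant (s t : R) :
  (forall i j, L (fun x => f x ^+ i * g x ^+ j) = 0) ->
  mu ([set x | f x < s] `&` [set x | g x < t]) =
  nu ([set x | f x < s] `&` [set x | g x < t]).
Proof.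
move=> L0.
have n1 : null_moments (cst 1).
  split; first exact: bounded_mfun_cst.
  by move=> i j; under [fun x => _]funext do rewrite mul1r; exact: L0.
have := null_moments_dint (null_moments_indic s (or_introl erefl)
  (null_moments_indic t (or_intror erefl) n1)).
move=> h; apply: dint_indic.
  by apply: measurableI; exact: measurable_lt_cst.
rewrite -h; congr L; apply/funext => x /=.
by rewrite mulr1 indicI.
Qed.

End moments_to_measure.

(** * The kernel (1 - <z, w>) `^ a determines the moments *)

Section kernel.
Context d (T : measurableType d) (R : realType) (mu nu : probability T R).
Local Notation L := (dint mu nu).
Variables (a : R) (f g : T -> R).
Hypotheses (a0 : 0 < a) (a1 : a < 1).
Hypotheses (mf : measurable_fun setT f) (mg : measurable_fun setT g).
Hypothesis fg1 : forall x, f x ^+ 2 + g x ^+ 2 <= 1.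

Let K z w := f z * f w + g z * g w.

Let f1 x : `|f x| <= 1.
Proof.
rewrite -(@expr_le1 _ 2)// real_normK ?num_real// (le_trans _ (fg1 x))//.
by rewrite lerDl sqr_ge0.
Qed.

Let g1 x : `|g x| <= 1.
Proof.
rewrite -(@expr_le1 _ 2)// real_normK ?num_real// (le_trans _ (fg1 x))//.
by rewrite lerDr sqr_ge0.
Qed.

Let bf : bounded_mfun f. Proof. by split => //; exists 1. Qed.
Let bg : bounded_mfun g. Proof. by split => //; exists 1. Qed.

Let bfg i j : bounded_mfun (fun x => f x ^+ i * g x ^+ j).
Proof. by apply: bounded_mfunM; apply: bounded_mfunX. Qed.

Let K1 z w : `|K z w| <= 1.
Proof.
have h1 := fg1 z; have h2 := fg1 w; rewrite /K.
rewrite ler_norml; apply/andP; split.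
  have := sqr_ge0 (f z + f w); have := sqr_ge0 (g z + g w); lra.
have := sqr_ge0 (f z - f w); have := sqr_ge0 (g z - g w); lra.
Qed.

Let bZ (c : R) h : bounded_mfun h -> bounded_mfun (fun x : T => c * h x : R).
Proof. by move=> bh; apply: bounded_mfunM => //; exact: bounded_mfun_cst. Qed.

Let bK z : bounded_mfun (K z).
Proof. by apply: bounded_mfunD; exact: bZ. Qed.

Definition moment i j := L (fun x => f x ^+ i * g x ^+ j).

(** By [dint2_kernelX] this is the double integral of K z w ^+ k against the
signed measure mu - nu in both variables. *)
Definition energy k := \sum_(i < k.+1) moment (k - i) i ^+ 2 *+ 'C(k, i).

Lemma dint_kernelX z k : L (fun w => K z w ^+ k) =
  \sum_(i < k.+1)
    ('C(k, i)%:R * moment (k - i) i) * (f z ^+ (k - i) * g z ^+ i).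
Proof.
transitivity (L (fun w => \sum_(i < k.+1)
    ('C(k, i)%:R * (f z ^+ (k - i) * g z ^+ i)) *
    (f w ^+ (k - i) * g w ^+ i))).
  congr L; apply/funext => w; rewrite /K exprDn; apply: eq_bigr => i _.
  by rewrite -mulr_natl !exprMn; ring.
rewrite dint_sum; last by move=> i; exact: bZ.
apply: eq_bigr => i _; rewrite dintZ// -/(moment _ _); ring.
Qed.

Lemma dint2_kernelX k : L (fun z => L (fun w => K z w ^+ k)) = energy k.
Proof.
under [fun z => _]funext do rewrite dint_kernelX.
rewrite dint_sum; last by move=> i; exact: bZ.
apply: eq_bigr => i _; rewrite dintZ// -/(moment _ _) -mulr_natl; ring.
Qed.

Lemma energy_ge0 k : 0 <= energy k.
Proof. by apply: sumr_ge0 => i _; rewrite mulrn_wge0// sqr_ge0. Qed.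

Lemma energy0 : energy 0 = 0.
Proof.
rewrite /energy big_ord1 /moment subnn.
under [fun x => _]funext do rewrite !expr0 mul1r.
by rewrite dint_cst expr0n mul0rn.
Qed.

Hypothesis pot0 : forall z, L (fun w => (1 - K z w) `^ a) = 0.

(** The polynomial G approximates a kernel with vanishing potential, so its
double integral, the sum of the c_i * r ^+ i * energy i, is small. All its terms
are nonpositive, hence each of them is small; the bound - c_k / 2 ^ k on the
coefficient in degree k does not depend on the quality e of the
approximation. *)
Lemma energy_eq0 k : energy k = 0.
Proof.
case: k => [|k]; first exact: energy0.
apply/eqP; rewrite eq_le energy_ge0 andbT.
pose b := - pow1B_coef a k.+1 * 2^-1 ^+ k.+1.
have b0 : 0 < b by rewrite mulr_gt0 ?exprn_gt0// oppr_gt0 pow1B_coef_lt0.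
rewrite -(pmulr_rle0 _ b0); apply/ler_addgt0Pr => e e0; rewrite add0r.
(* dint_le is used in each variable, and costs a factor 2 each time *)
have [|r [/andP[r2 r1] ap]] := @pow1B_approx R a a0 a1 (e / 4).
  by rewrite divr_gt0.
have r0 : 0 <= r by rewrite (le_trans _ r2).
have [N _ /(_ (maxn N k.+1) (leq_maxl _ _))] := ap.
have : (k.+1 <= maxn N k.+1)%N := leq_maxr _ _.
move: (maxn _ _) => n kn /= apn.
pose G z w := pow1B_sum a n (r * K z w).
have GE z w : G z w = \sum_(i < n.+1) (pow1B_coef a i * r ^+ i) * K z w ^+ i.
  by apply: eq_bigr => i _; rewrite exprMn mulrA.
have bG z : bounded_mfun (G z).
  under [G z]funext do rewrite GE.
  by apply: bounded_mfun_sum => i; apply/bZ/bounded_mfunX.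
have LG z : L (G z) =
    \sum_(i < n.+1) (pow1B_coef a i * r ^+ i) * L (fun w => K z w ^+ i).
  under [G z]funext do rewrite GE.
  rewrite dint_sum; last by move=> i; apply/bZ/bounded_mfunX.
  by apply: eq_bigr => i _; rewrite dintZ//; exact: bounded_mfunX.
have bLK i : bounded_mfun (fun z => L (fun w => K z w ^+ i)).
  under [fun z => _]funext do rewrite dint_kernelX.
  by apply: bounded_mfun_sum => j; exact: bZ.
have bLG : bounded_mfun (fun z => L (G z)).
  under [fun z => _]funext do rewrite LG.
  by apply: bounded_mfun_sum => j; exact: bZ.
have LLG : L (fun z => L (G z)) =
    \sum_(i < n.+1) (pow1B_coef a i * r ^+ i) * energy i.
  under [fun z => _]funext do rewrite LG.
  rewrite dint_sum; last by move=> i; exact: bZ.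
  by apply: eq_bigr => i _; rewrite dintZ// dint2_kernelX.
have bP z : bounded_mfun (fun w => (1 - K z w) `^ a).
  split.
    apply: (measurableT_comp (measurable_powR a)).
    by apply: measurable_funB => //; exact: (bK z).1.
  exists (2 `^ a) => w; rewrite ger0_norm ?powR_ge0//.
  have := K1 z w; rewrite ler_norml => /andP[h1 h2].
  by apply: (ge0_ler_powR (ltW a0)); rewrite ?nnegrE; lra.
have LGe z : `|L (G z)| <= 2 * (e / 4).
  have -> : L (G z) = L (fun w => G z w - (1 - K z w) `^ a).
    by rewrite dintB// pot0 subr0.
  apply: dint_le; last by move=> w; exact: apn.
  under [fun x => _]funext do rewrite -mulN1r.
  by apply: bounded_mfunD => //; exact: bZ.
have := dint_le mu nu bLG LGe; rewrite LLG ler_norml => /andP[+ _].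
rewrite lerNl (_ : 2 * (2 * (e / 4)) = e); last by lra.
apply: le_trans; rewrite big_ord_recl energy0 mulr0 add0r -sumrN.
have kn' : (k < n)%N by [].
rewrite (bigD1 (Ordinal kn'))//= -[leLHS]addr0 lerD//.
  rewrite -mulNr ler_wpM2r ?energy_ge0// /b -[leRHS]mulNr ler_wpM2l//.
    by rewrite oppr_ge0 ltW// pow1B_coef_lt0.
  by rewrite lerXn2r ?nnegrE.
apply: sumr_ge0 => i _; rewrite oppr_ge0 mulr_le0_ge0 ?energy_ge0//.
by rewrite mulr_le0_ge0 ?exprn_ge0// ltW// pow1B_coef_lt0.
Qed.

Lemma moment_eq0 i j : moment i j = 0.
Proof.
have /eqP := energy_eq0 (i + j); rewrite psumr_eq0; last first.
  by move=> k _; rewrite mulrn_wge0// sqr_ge0.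
have ji : (j < (i + j).+1)%N by rewrite ltnS leq_addl.
move=> /allP/(_ (Ordinal ji)); rewrite mem_index_enum => /(_ isT)/=.
rewrite addnK mulrn_eq0 sqrf_eq0 => /orP[|/eqP//].
by rewrite eqn0Ngt bin_gt0 leq_addl.
Qed.

End kernel.

(** * The circle in coordinates *)

Section circle_coordinates.
Context {R : realType}.
Implicit Types z w : circle R.

Definition cre z : R := complex.Re (val z).
Definition cim z : R := complex.Im (val z).

Lemma circle_eqP z w : cre z = cre w -> cim z = cim w -> z = w.
Proof.
rewrite /cre /cim => hr hi; apply: val_inj.
by case: (val z) (val w) hr hi => [a b] [c e] /= -> ->.
Qed.

Lemma circle_sqr z : cre z ^+ 2 + cim z ^+ 2 = 1.
Proof.
rewrite /cre /cim; case: z => -[a b] /= /eqP ab.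
by rewrite -[LHS]sqr_sqrtr ?addr_ge0 ?sqr_ge0// ab expr1n.
Qed.

Definition cdot z w : R := cre z * cre w + cim z * cim w.

Lemma mdist_sqr z w : mdist z w ^+ 2 = (1 - cdot z w) / 2.
Proof.
rewrite /mdist/= /circle_dist ComplexField.Normc.normcM.
have -> : normc (2^-1 : R[i]) = 2^-1.
  by rewrite ComplexField.Normc.normcV -[2]/(1 *+ 2) normcMn
    ComplexField.Normc.normc1.
have := circle_sqr z; have := circle_sqr w; rewrite /cdot /cre /cim.
case: (val z) (val w) => [a b] [c e] /= h1 h2.
rewrite exprMn sqr_sqrtr ?addr_ge0 ?sqr_ge0// !sqrrB.
lra.
Qed.

Lemma mdist_powR (p : R) z w : mdist z w `^ p = ((1 - cdot z w) / 2) `^ (p / 2).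
Proof.
by rewrite -mdist_sqr -powR_mulrn ?mdist_ge0// -powRrM mulrCA divff ?mulr1.
Qed.

Lemma cdot_bound z w : -1 <= cdot z w <= 1.
Proof.
have h1 := circle_sqr z; have h2 := circle_sqr w; rewrite /cdot.
apply/andP; split.
  have := sqr_ge0 (cre z + cre w); have := sqr_ge0 (cim z + cim w); lra.
have := sqr_ge0 (cre z - cre w); have := sqr_ge0 (cim z - cim w); lra.
Qed.

Lemma mdist_le1 z w : mdist z w <= 1.
Proof.
rewrite -(@expr_le1 _ 2)// ?mdist_ge0// mdist_sqr.
have /andP[] := cdot_bound z w; lra.
Qed.

Let antipode_subproof z : normc (- val z) == 1.
Proof. by case: z => -[a b] /=; rewrite !sqrrN. Qed.

Definition antipode z : circle R := exist _ (- val z) (antipode_subproof z).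

Lemma cre_antipode z : cre (antipode z) = - cre z.
Proof. by rewrite /cre /=; case: (val z). Qed.

Lemma cim_antipode z : cim (antipode z) = - cim z.
Proof. by rewrite /cim /=; case: (val z). Qed.

Lemma mdist_antipode z : mdist (antipode z) z = 1.
Proof.
apply/eqP; rewrite -(@eqrXn2 _ 2)// ?mdist_ge0// expr1n mdist_sqr /cdot.
rewrite cre_antipode cim_antipode; have := circle_sqr z => h; apply/eqP; lra.
Qed.

Lemma mdist_eq1 z w : mdist z w = 1 -> w = antipode z.
Proof.
move=> h; have := mdist_sqr z w; rewrite h expr1n /cdot => e.
have h1 := circle_sqr z; have h2 := circle_sqr w.
have : (cre z + cre w) ^+ 2 + (cim z + cim w) ^+ 2 = 0 by lra.
move/eqP; rewrite paddr_eq0 ?sqr_ge0// !sqrf_eq0 !addr_eq0.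
move=> /andP[/eqP hr /eqP hi].
by apply: circle_eqP; rewrite ?cre_antipode ?cim_antipode ?hr ?hi opprK.
Qed.

Lemma cre_lip z w : `|cre z - cre w| <= 2 * mdist z w.
Proof.
rewrite -(@ler_pXn2r _ 2) ?nnegrE ?mulr_ge0 ?mdist_ge0//.
rewrite exprMn mdist_sqr real_normK ?num_real//.
have := circle_sqr z; have := circle_sqr w; rewrite /cdot.
have := sqr_ge0 (cim z - cim w); lra.
Qed.

Lemma cim_lip z w : `|cim z - cim w| <= 2 * mdist z w.
Proof.
rewrite -(@ler_pXn2r _ 2) ?nnegrE ?mulr_ge0 ?mdist_ge0//.
rewrite exprMn mdist_sqr real_normK ?num_real//.
have := circle_sqr z; have := circle_sqr w; rewrite /cdot.
have := sqr_ge0 (cre z - cre w); lra.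
Qed.

Lemma mdist_le_coord z w : mdist z w <= `|cre z - cre w| + `|cim z - cim w|.
Proof.
rewrite -(@ler_pXn2r _ 2) ?nnegrE ?addr_ge0 ?mdist_ge0//.
rewrite mdist_sqr sqrrD !real_normK ?num_real//.
have : 0 <= `|cre z - cre w| * `|cim z - cim w| by rewrite mulr_ge0.
have := circle_sqr z; have := circle_sqr w; rewrite /cdot.
have := sqr_ge0 (cre z - cre w); have := sqr_ge0 (cim z - cim w); lra.
Qed.

Lemma lip_continuous (f : circle R -> R) :
  (forall z w, `|f z - f w| <= 2 * mdist z w) -> continuous f.
Proof.
move=> fl z; apply/(@cvgrPdist_lt _ _ _ (nbhs z)) => e e0.
apply/(@metricType_numDomainType.nbhs_mdistP R (circle R)).
exists (e / 2) => /=; first by rewrite divr_gt0.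
move=> w /= zw; rewrite (le_lt_trans (fl _ _))// mulrC -ltr_pdivlMr//.
Qed.

Lemma circle_measurable_continuous (f : circle R -> R) :
  continuous f -> measurable_fun setT f.
Proof.
move=> /continuousP cf; apply: (measurability _ (RGenOpens.measurableE R)).
move=> _ [_ [a [b ->]] <-]; rewrite setTI; apply: sub_sigma_algebra.
exact/cf/interval_open.
Qed.

Lemma measurable_cre : measurable_fun setT cre.
Proof.
by apply: circle_measurable_continuous; apply: lip_continuous; exact: cre_lip.
Qed.

Lemma measurable_cim : measurable_fun setT cim.
Proof.
by apply: circle_measurable_continuous; apply: lip_continuous; exact: cim_lip.
Qed.

Lemma cre_le1 z : `|cre z| <= 1.
Proof.
rewrite -(@expr_le1 _ 2)// real_normK ?num_real// -(circle_sqr z).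
by rewrite lerDl sqr_ge0.
Qed.

Lemma cim_le1 z : `|cim z| <= 1.
Proof.
rewrite -(@expr_le1 _ 2)// real_normK ?num_real// -(circle_sqr z).
by rewrite lerDr sqr_ge0.
Qed.

Definition quadrant (s t : R) : set (circle R) :=
  [set z | cre z < s] `&` [set z | cim z < t].

Definition quadrants : set (set (circle R)) :=
  [set quadrant st.1 st.2 | st in [set: R * R]].

Lemma quadrants_setI : setI_closed quadrants.
Proof.
move=> _ _ [[s t] _ <-] [[s' t'] _ <-] /=.
exists (Num.min s s', Num.min t t') => //=.
rewrite /quadrant setIACA; congr (_ `&` _); apply/seteqP; split => z /=.
- by rewrite lt_min => /andP.
- by move=> [? ?]; rewrite lt_min; apply/andP.
- by rewrite lt_min => /andP.
- by move=> [? ?]; rewrite lt_min; apply/andP.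
Qed.

Lemma lt_coord_setT (h : circle R -> R) : (forall z, `|h z| <= 1) ->
  [set z | h z < 2] = setT.
Proof.
move=> h1; apply/seteqP; split => z //= _.
by rewrite (le_lt_trans (ler_norm _))// (le_lt_trans (h1 z))// ltr1n.
Qed.

Lemma quadrantT : quadrant 2 2 = setT.
Proof.
by rewrite /quadrant (lt_coord_setT cre_le1) (lt_coord_setT cim_le1) setIT.
Qed.

Lemma measurable_quadrant s t : measurable (quadrant s t).
Proof.
by apply: measurableI; apply: measurable_lt_cst;
  [exact: measurable_cre|exact: measurable_cim].
Qed.

Let box (i : rat * rat * nat) : set (circle R) :=
  [set z | `|cre z - ratr i.1.1| < i.2.+1%:R^-1] `&`
  [set z | `|cim z - ratr i.1.2| < i.2.+1%:R^-1].

Let box_cover z n : exists q : rat * rat, box (q, n) z.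
Proof.
have n0 : 0 < n.+1%:R^-1 :> R by rewrite invr_gt0.
have h (x : R) : exists q, `|x - ratr q| < n.+1%:R^-1.
  have [|q] := @rat_in_itvoo R (x - n.+1%:R^-1) (x + n.+1%:R^-1).
    by rewrite ltrD2l (lt_trans _ n0)// oppr_lt0.
  by rewrite in_itv/= -ltr_distl distrC => ?; exists q.
have [q qz] := h (cre z); have [s sz] := h (cim z).
by exists (q, s).
Qed.

Let box_small i z w : box i z -> box i w -> mdist z w <= 4 / i.2.+1%:R.
Proof.
move=> [/= z1 z2] [/= w1 w2]; rewrite (le_trans (mdist_le_coord _ _))//.
move: z1 z2 w1 w2; rewrite !ltr_norml.
move: (_^-1) (ratr _) (ratr _) => e q s.
move=> /andP[a1 a2] /andP[b1 b2] /andP[c1 c2] /andP[d1 d2].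
have e1 : `|cre z - cre w| <= 2 * e.
  by rewrite ler_norml; apply/andP; split; lra.
have e2 : `|cim z - cim w| <= 2 * e.
  by rewrite ler_norml; apply/andP; split; lra.
lra.
Qed.

Local Notation Q := (g_sigma_algebraType quadrants).

Let box_quadrants i : <<s quadrants >> (box i).
Proof.
have mcoord (h : Q -> R) : (forall t, <<s quadrants >> [set z | h z < t]) ->
    measurable_fun setT h.
  move=> ht; apply: (measurability _ (RGenInftyO.measurableE R)).
  move=> _ [_ [a ->] <-]; rewrite setTI.
  have -> : h @^-1` `]-oo, a[ = [set z | h z < a]; last exact: ht.
  by apply/seteqP; split => x /=; rewrite in_itv.
have mre : measurable_fun setT (cre : Q -> R).
  apply: mcoord => t; apply: sub_sigma_algebra; exists (t, 2) => //=.
  by rewrite /quadrant (lt_coord_setT cim_le1) setIT.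
have mim : measurable_fun setT (cim : Q -> R).
  apply: mcoord => t; apply: sub_sigma_algebra; exists (2, t) => //=.
  by rewrite /quadrant (lt_coord_setT cre_le1) setTI.
have mslab (h : Q -> R) c e : measurable_fun setT h ->
    measurable [set z : Q | `|h z - c| < e].
  move=> mh; rewrite -[X in measurable X]setTI.
  have -> : [set z | `|h z - c| < e] = h @^-1` `]c - e, c + e[.
    by apply/seteqP; split => x /=; rewrite in_itv/= ltr_distl.
  by apply: mh => //; exact: measurable_itv.
exact: (@measurableI _ Q _ _ (mslab _ _ _ mre) (mslab _ _ _ mim)).
Qed.

(** An open set is the union of the countably many boxes with rational centres
that it contains. *)
Lemma circle_measurableE : @measurable _ (circle R) = <<s quadrants >>.
Proof.
apply/seteqP; split; last first.
  apply: smallest_sub; first exact: sigma_algebra_measurable.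
  by move=> _ [[s t] _ <-]; exact: measurable_quadrant.
apply: smallest_sub; first exact: smallest_sigma_algebra.
move=> U oU.
have -> : U = \bigcup_(i in [set i | box i `<=` U]) box i.
  apply/seteqP; split => [z Uz|z [i /= iU iz]]; last exact: iU.
  have : nbhs z U by exact: open_nbhs_nbhs.
  move=> /(@metricType_numDomainType.nbhs_mdistP R (circle R))[e/= e0 eP].
  have e40 : 0 < e / 4 by rewrite divr_gt0.
  have [n] : exists n, n.+1%:R^-1 < e / 4.
    have [n _] := near_infty_natSinv_lt (PosNum e40).
    by move/(_ n (leqnn n)) => /=; exists n.
  rewrite ltr_pdivlMr// mulrC => ne.
  have [q qz] := box_cover z n.
  exists (q, n) => //= w qw; apply: eP => /=.
  by rewrite (le_lt_trans (box_small qz qw)).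
rewrite bigcup_mkcond; apply: (@countable_bigcupT_measurable _ Q) => [|i].
  exact: countableP.
by case: ifPn => _; [exact: box_quadrants|exact: (@measurable0 _ Q)].
Qed.

Lemma eq_borel_quadrant (mu nu : probability (circle R) R) :
  (forall s t, mu (quadrant s t) = nu (quadrant s t)) -> eq_borel mu nu.
Proof.
move=> h A mA.
apply: (measure_unique quadrants (fun=> setT) circle_measurableE
  quadrants_setI) => //.
- by move=> _; exists (2, 2) => //=; rewrite quadrantT.
- by rewrite bigcup_const//; exists 0%N.
- by move=> _ [[s t] _ <-]; exact: h.
- by move=> _; rewrite (le_lt_trans (probability_le1 _ _))// ltry.
Qed.

(** [moment_eq0] applies with the real and imaginary parts as coordinates,
because mdist w z `^ p is proportional to (1 - cdot z w) `^ (p / 2). *)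
Lemma potential_inj (p : R) (mu nu : probability (circle R) R) : 0 < p < 2 ->
  (forall z, (\int[mu]_w (mdist w z `^ p)%:E =
              \int[nu]_w (mdist w z `^ p)%:E)%E) ->
  eq_borel mu nu.
Proof.
move=> /andP[p0 p2] h; apply: eq_borel_quadrant => s t.
apply: moments_quadrant.
- exact: measurable_cre.
- exact: measurable_cim.
- exact: cre_le1.
- exact: cim_le1.
pose a := p / 2.
have a0 : 0 < a by rewrite divr_gt0.
have a1 : a < 1 by rewrite /a; lra.
have fg1 z : cre z ^+ 2 + cim z ^+ 2 <= 1 by rewrite circle_sqr.
apply: (moment_eq0 a0 a1 measurable_cre measurable_cim fg1) => z.
have E (m : probability (circle R) R) :
    \int[m]_w (1 - cdot z w) `^ a = 2 `^ a * \int[m]_w (mdist w z `^ p).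
  rewrite -RintegralZl//.
    apply: eq_Rintegral => w _; rewrite mdist_powR -/a /cdot.
    have /andP[k0 k1] := cdot_bound w z.
    rewrite -powRM ?divr_ge0 ?subr_ge0// mulrCA divff ?mulr1//.
    by congr ((1 - _) `^ _); rewrite /cdot; ring.
  apply: bounded_mfun_integrable; split.
    under [fun x => _]funext do rewrite mdist_powR.
    apply: (measurableT_comp (measurable_powR _)).
    apply: measurable_funM => //; apply: measurable_funB => //.
    by apply: measurable_funD; apply: measurable_funM => //;
      [exact: measurable_cre|exact: measurable_cim].
  exists 1 => w; rewrite ger0_norm ?powR_ge0//.
  have -> : (1 : R) = 1 `^ p by rewrite powR1.
  by apply: (ge0_ler_powR (ltW p0)); rewrite ?nnegrE ?mdist_ge0 ?mdist_le1.
by rewrite /dint !E /Rintegral h subrr.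
Qed.

End circle_coordinates.

(** * Wasserstein distances to Dirac masses *)

Section wasserstein_circle.
Context {R : realType}.
Implicit Types (z w : circle R) (mu nu : probability (circle R) R).
Local Open Scope ereal_scope.

Lemma ae_eq1 d (T : measurableType d) (m : probability T R) (h : T -> R) :
  measurable_fun setT h -> (forall x, (0 <= h x <= 1)%R) ->
  1 <= \int[m]_x (h x)%:E -> {ae m, forall x, h x = 1%R}.
Proof.
move=> mh h01 i1.
have bh : bounded_mfun h.
  by split => //; exists 1%R => x; have /andP[? ?] := h01 x; rewrite ger0_norm.
have b1 := bounded_mfun_cst T (1 : R).
have : \int[m]_x `|(1 - h x)%:E| = 0.
  under eq_integral => x _.
    rewrite gee0_abs; last by rewrite lee_fin subr_ge0; have /andP[] := h01 x.
    over.
  rewrite integralB_EFin//; [|exact: bounded_mfun_integrable..].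
  rewrite integral_cst// [X in 1 * X]probability_setT mule1.
  apply/eqP; rewrite eq_le; apply/andP; split.
    rewrite leeBlDr ?add0e// integrable_fin_num//.
    exact: bounded_mfun_integrable.
  rewrite sube_ge0//; last first.
    by rewrite integrable_fin_num//; exact: bounded_mfun_integrable.
  rewrite -[leRHS](_ : \int[m]_x 1 = 1); last first.
    by rewrite integral_cst// [X in 1 * X]probability_setT mule1.
  apply: ge0_le_integral => //.
  - by move=> x _; rewrite lee_fin; have /andP[] := h01 x.
  - exact/measurable_EFinP.
  - by move=> x _; rewrite lee_fin; have /andP[] := h01 x.
move=> /(ae_eq_integral_abs _ measurableT) => /(_ _)[].
  by apply/measurable_EFinP/measurable_funB.
move=> N [mN N0 sub]; exists N; split => // x /= h1.
apply: sub => /= h2; apply: h1.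
by have [/eqP] := h2 Logic.I; rewrite subr_eq0 => /eqP.
Qed.

Variable p : R.
Hypothesis p0 : (0 < p)%R.

Definition cost z w : R := (mdist z w `^ p)%R.

Lemma cost01 z w : (0 <= cost z w <= 1)%R.
Proof.
rewrite powR_ge0/=; have -> : (1 = 1 `^ p :> R)%R by rewrite powR1.
by apply: (ge0_ler_powR (ltW p0)); rewrite ?nnegrE ?mdist_ge0 ?mdist_le1.
Qed.

Lemma measurable_cost d (T : measurableType d) (f g : T -> circle R) :
  measurable_fun setT f -> measurable_fun setT g ->
  measurable_fun setT (fun x => cost (f x) (g x)).
Proof.
move=> mf mg; rewrite /cost; under [fun x => _]funext do rewrite mdist_powR.
apply: (measurableT_comp (measurable_powR _)).
apply: measurable_funM => //; apply: measurable_funB => //.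
by apply: measurable_funD; apply: measurable_funM;
  apply: measurableT_comp => //;
  (exact: measurable_cre || exact: measurable_cim).
Qed.

Lemma cost_eq1 z w : cost z w = 1%R -> w = antipode z.
Proof.
move=> h; apply: mdist_eq1.
have := powRrM (mdist z w) p p^-1.
by rewrite divff ?gt_eqF// powRr1 ?mdist_ge0// -/(cost z w) h powR1.
Qed.

Lemma measurable_circle_set1 z : measurable [set z].
Proof.
have mc : measurable_fun setT (fun w => cost z w) by exact: measurable_cost.
rewrite -[X in measurable X]setTI.
have -> : [set z] = (fun w => cost z w) @^-1` [set 0%R].
  apply/seteqP; split => w /=.
    by move=> ->; rewrite /cost mdistxx powR0// gt_eqF.
  by move=> /powR_eq0_eq0/mdist_positivity.
by apply: mc => //; exact: measurable_set1.
Qed.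

Lemma eq_borel_dirac nu z : nu [set z] = 1 -> eq_borel nu (\d_z).
Proof.
move=> nz A mA; rewrite diracE; apply/eqP; rewrite eq_le.
have [/set_mem zA|/negP zA] := boolP (z \in A).
  rewrite probability_le1//= -nz; apply: le_measure; rewrite ?inE//.
    exact: measurable_circle_set1.
  by move=> _ ->.
rewrite measure_ge0 andbT.
have -> : false%:R%:E = nu (~` [set z]).
  rewrite probability_setC; last exact: measurable_circle_set1.
  by rewrite nz subee.
apply: le_measure; rewrite ?inE//.
  by apply: measurableC; exact: measurable_circle_set1.
by move=> w Aw wz; apply: zA; rewrite inE -wz.
Qed.

Lemma wasserstein_dist_eq_borel mu mu' nu nu' :
  eq_borel mu mu' -> eq_borel nu nu' ->
  wasserstein_dist p mu nu = wasserstein_dist p mu' nu'.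
Proof.
move=> hm hn; rewrite /wasserstein_dist; congr (ereal_inf (image _ _) `^ _).
apply/seteqP; split => g /= -[g1 g2]; split => A mA.
- by rewrite g1// hm.
- by rewrite g2// hn.
- by rewrite g1// hm.
- by rewrite g2// hn.
Qed.

Lemma coupling_product mu nu : coupling mu nu (mu \x nu : probability _ _).
Proof.
split => A mA; rewrite /pushforward.
  have -> : fst @^-1` A = A `*` [set: circle R].
    by apply/seteqP; split => x //= [].
  transitivity (mu A * nu setT); first exact: product_measure1E.
  by rewrite probability_setT mule1.
have -> : snd @^-1` A = [set: circle R] `*` A.
  by apply/seteqP; split => x //= [].
transitivity (mu setT * nu A); first exact: product_measure1E.
by rewrite probability_setT mul1e.
Qed.

Lemma wasserstein_powR mu nu : (wasserstein_dist p mu nu) `^ p =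
  ereal_inf [set \int[g]_x (cost x.1 x.2)%:E | g in coupling mu nu].
Proof.
rewrite /wasserstein_dist -poweRrM mulVf ?gt_eqF// poweRe1//.
apply: le_ereal_inf_tmp => _ [g _ <-]; apply: integral_ge0 => x _.
by rewrite lee_fin powR_ge0.
Qed.

(** The cost is at most 1, so its integral against the product coupling can only
reach 1 if it is 1 almost everywhere. By Fubini there is then a single x such
that nu-almost every point is at distance 1 from x. *)
Lemma wasserstein_eq1_dirac mu nu : wasserstein_dist p mu nu = 1 ->
  exists z, eq_borel nu (\d_z).
Proof.
move=> W1; have := wasserstein_powR mu nu; rewrite W1 poweR1r => /esym I1.
have : 1 <= \int[mu \x nu]_x (cost x.1 x.2)%:E.
  rewrite -I1; apply: ereal_inf_lbound.
  by exists (mu \x nu : probability _ _) => //; exact: coupling_product.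
have mc2 : measurable_fun setT
    (fun x : circle R * circle R => (cost x.1 x.2)%:E).
  by apply/measurable_EFinP; exact: measurable_cost.
rewrite fubini_tonelli1//; last by move=> x; rewrite lee_fin powR_ge0.
rewrite /fubini_F/= => i1.
have mF : measurable_fun setT (fun x => \int[nu]_y (cost x y)%:E).
  apply: (measurable_fun_fubini_tonelli_F
    (fun x : circle R * circle R => (cost x.1 x.2)%:E)) => //.
  by move=> x; rewrite lee_fin powR_ge0.
have F0 x : 0 <= \int[nu]_y (cost x y)%:E.
  by apply: integral_ge0 => y _; rewrite lee_fin powR_ge0.
have mc x : measurable_fun setT (cost x) by exact: measurable_cost.
have F1 x : \int[nu]_y (cost x y)%:E <= 1.
  rewrite -[leRHS](_ : \int[nu]_y 1 = 1); last first.
    by rewrite integral_cst// [X in 1 * X]probability_setT mule1.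
  apply: ge0_le_integral => //.
  - by move=> y _; rewrite lee_fin powR_ge0.
  - exact/measurable_EFinP.
  - by move=> y _; rewrite lee_fin; have /andP[] := cost01 x y.
have Ffin x : \int[nu]_y (cost x y)%:E \is a fin_num.
  by rewrite ge0_fin_numE// (le_lt_trans (F1 x))// ltry.
have : {ae mu, forall x, fine (\int[nu]_y (cost x y)%:E) = 1%R}.
  apply: ae_eq1.
  - exact: measurableT_comp.
  - by move=> x; rewrite -!lee_fin fineK// F0 F1.
  - by under eq_integral do rewrite fineK//.
move=> [N [mN N0 sub]].
have [x xN] : exists x, ~ N x.
  apply/not_existsP => NT.
  have NE : N = setT by apply/seteqP; split => // x _; exact: contrapT (NT x).
  by move: N0; rewrite NE probability_setT => /eqP; rewrite onee_eq0.
have Fx : fine (\int[nu]_y (cost x y)%:E) = 1%R.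
  by apply: contrapT => h; exact/xN/sub.
have [M [mM M0 subM]] : {ae nu, forall y, cost x y = 1%R}.
  apply: ae_eq1 => //; first exact: cost01.
  by rewrite -(fineK (Ffin x)) Fx.
exists (antipode x); apply: eq_borel_dirac.
have mz := measurable_circle_set1 (antipode x).
have z0 : nu (~` [set antipode x]) = 0.
  apply: (subset_measure0 _ mM _ M0) => //; first exact: measurableC.
  by move=> y yx; apply: subM => /= /cost_eq1.
by rewrite -[X in nu X]setCK probability_setC ?z0 ?sube0//; exact: measurableC.
Qed.

(** The second marginal of a coupling with a Dirac mass at z puts all of its
mass on the points whose second component is z. *)
Lemma coupling_dirac_cost mu z (g : probability (circle R * circle R)%type R) :
  coupling mu (\d_z) g ->
  \int[g]_x (cost x.1 x.2)%:E = \int[mu]_w (cost w z)%:E.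
Proof.
move=> [g1 g2].
have mz := measurable_circle_set1 z.
have mc2 : measurable_fun setT
    (fun x : circle R * circle R => (cost x.1 x.2)%:E).
  by apply/measurable_EFinP; exact: measurable_cost.
have mc : measurable_fun setT (fun w => (cost w z)%:E).
  by apply/measurable_EFinP; exact: measurable_cost.
transitivity (\int[g]_x (cost x.1 z)%:E).
  apply: ge0_ae_eq_integral => //.
  - by apply/measurable_EFinP; exact: measurable_cost.
  - by move=> x _; rewrite lee_fin powR_ge0.
  - by move=> x _; rewrite lee_fin powR_ge0.
  exists (snd @^-1` (~` [set z])); split.
  - rewrite -[X in measurable X]setTI.
    by apply: measurable_snd => //; exact: measurableC.
  - transitivity (\d_z (~` [set z]) : \bar R).
      by apply: (g2 (~` [set z])); exact: measurableC.
    by rewrite diracE memNset//; apply.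
  - by move=> x /= h hz; apply: h => _; rewrite hz.
have := @ge0_integral_pushforward _ _ _ _ R _
  (@measurable_fst _ _ (circle R) (circle R)) g setT _ measurableT mc.
rewrite preimage_setT => <-; last by move=> w _; rewrite lee_fin powR_ge0.
by apply: eq_measure_integral => A mA _; exact: g1.
Qed.

Lemma wasserstein_dirac mu z :
  (wasserstein_dist p mu (\d_z)) `^ p = \int[mu]_w (cost w z)%:E.
Proof.
rewrite wasserstein_powR -[RHS]ereal_inf1; congr ereal_inf.
apply/seteqP; split => [_ [g cg <-]/=|_ ->/=]; first exact: coupling_dirac_cost.
exists (mu \x \d_z : probability _ _); first exact: coupling_product.
by apply: coupling_dirac_cost; exact: coupling_product.
Qed.

Lemma wasserstein_dirac2 w z :
  wasserstein_dist p (\d_w) (\d_z) = (mdist w z)%:E.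
Proof.
rewrite -[LHS](@poweRe1 R) ?poweR_ge0// -(mulfV (lt0r_neq0 p0)) poweRrM.
rewrite wasserstein_dirac integral_dirac//; last first.
  by apply/measurable_EFinP; exact: measurable_cost.
rewrite diracT mul1e poweR_EFin /cost -powRrM divff ?gt_eqF//.
by rewrite powRr1 ?mdist_ge0.
Qed.

End wasserstein_circle.

(** * Isometries of the Wasserstein space *)

Section isometries.
Context {R : realType}.

Lemma measurable_metric_isometry (psi : circle R -> circle R) :
  metric_isometry psi -> measurable_fun setT psi.
Proof.
move=> [_ iso]; apply: (measurability (@open (circle R))) => //.
move=> _ [U oU <-]; rewrite setTI; apply: sub_sigma_algebra.
suff : open (psi @^-1` U : set (circle R)) by [].
rewrite openE => z /= Uz.
have : nbhs (psi z) U by exact: open_nbhs_nbhs.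
move=> /(@metricType_numDomainType.nbhs_mdistP R (circle R))[e/= e0 eU].
apply/(@metricType_numDomainType.nbhs_mdistP R (circle R)).
by exists e => //= w zw; apply: eU => /=; rewrite iso.
Qed.

(** Being at distance 1 from some measure is preserved by Psi and characterises
Dirac masses. Since Psi is onto, the same argument run backwards shows that
every Dirac mass is reached from a Dirac mass, so psi is onto. *)
Lemma dirac_image (p : R)
    (Psi : probability (circle R) R -> probability (circle R) R) :
  0 < p -> wasserstein_isometry p Psi ->
  exists psi : circle R -> circle R, metric_isometry psi /\
    forall z, eq_borel (Psi (\d_z)) (\d_(psi z)).
Proof.
move=> p0 [surj iso].
have /choice[psi psiP] z : exists w, eq_borel (Psi (\d_z)) (\d_w).
  apply: (wasserstein_eq1_dirac p0 (mu := Psi (\d_(antipode z)))).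
  by rewrite iso wasserstein_dirac2// mdist_antipode.
have psi_iso z w : mdist (psi z) (psi w) = mdist z w.
  apply: EFin_inj; rewrite -!(wasserstein_dirac2 p0) -[RHS]iso.
  by apply/esym/wasserstein_dist_eq_borel.
exists psi; split => //; split => // w.
have [mu muw] := surj (\d_w); have [nu nuw] := surj (\d_(antipode w)).
have [z muz] : exists z, eq_borel mu (\d_z).
  apply: (wasserstein_eq1_dirac p0 (mu := nu)).
  rewrite -iso (wasserstein_dist_eq_borel _ nuw muw).
  by rewrite wasserstein_dirac2// mdist_antipode.
exists z; apply/mdist_positivity/EFin_inj.
rewrite -(wasserstein_dirac2 p0).
rewrite -(wasserstein_dist_eq_borel p (psiP z) muw) iso.
rewrite (wasserstein_dist_eq_borel p (fun _ _ => erefl) muz).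
by rewrite wasserstein_dirac2// mdistxx.
Qed.

End isometries.

Theorem theorem3p1 (R : realType) (p : R) (Psi : probability (circle R) R -> probability (circle R) R) :
  1 <= p < 2 ->
  wasserstein_isometry p Psi ->
  exists psi : circle R -> circle R,
    metric_isometry psi /\
    forall mu : probability (circle R) R,
      eq_borel (Psi mu) (pushforward mu psi).
Proof.
move=> /andP[p1 p2] isoPsi; have p0 : 0 < p by rewrite (lt_le_trans _ p1).
have [psi [isopsi psiP]] := dirac_image p0 isoPsi.
exists psi; split => // mu.
have mpsi := measurable_metric_isometry isopsi.
pose mf := isMeasurableFun.Build _ _ _ _ psi mpsi.
pose psi' : {mfun circle R >-> circle R} := HB.pack psi mf.
pose nu : probability (circle R) R := distribution mu psi'.
change (eq_borel (Psi mu) nu).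
apply: (@potential_inj R p); first by rewrite p0.
move=> w; have [z <-] := isopsi.1 w.
have mc (v : circle R) :
    measurable_fun setT (fun w : circle R => (mdist w v `^ p)%:E).
  by apply/measurable_EFinP; exact: measurable_cost.
have := wasserstein_dirac p0 (Psi mu) (psi z).
rewrite /cost => <-.
rewrite -(wasserstein_dist_eq_borel p (fun _ _ => erefl) (psiP z)).
rewrite isoPsi.2 wasserstein_dirac//.
have := @ge0_integral_pushforward _ _ _ _ R psi mpsi mu setT _ measurableT
  (mc (psi z)).
rewrite preimage_setT => e.
transitivity (\int[pushforward mu psi]_w (mdist w (psi z) `^ p)%:E)%E.
  rewrite e; last by move=> v _; rewrite lee_fin powR_ge0.
  by apply: eq_integral => v _; rewrite /= isopsi.2.
exact: eq_measure_integral.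
Qed.
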